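(* Let $F$ be a field, let $n\ge1$, let $A = Fe_1\oplus\ldots\oplus Fe_n$ be the direct sum of $n$ copies of $F$, and let $\lambda\in F$, $\lambda\ne0$. A Rota–Baxter operator $R$ of weight $\lambda$ on $A$ is splitting if and only if the corresponding (labeled) rooted tree $T = T(R)$ on $n+1$ vertices is properly colored.
   Context: $A = Fe_1\oplus\ldots\oplus Fe_n$ is the $F$-algebra $F^n$ with $e_ie_j=\delta_{ij}e_i$. A Rota–Baxter operator of weight $\lambda$ on $A$ is an $F$-linear map $R\colon A\to A$ with $R(x)R(y) = R(R(x)y + xR(y) + \lambda xy)$ for all $x,y\in A$. $R$ is called splitting if there are subalgebras $A_1,A_2$ of $A$ (not necessarily unital, possibly zero) such that $A = A_1\dotplus A_2$ is a direct sum of vector spaces and $R(a_1+a_2) = -\lambda a_2$ for all $a_1\in A_1$, $a_2\in A_2$. The colored rooted tree $T(R)$: write $R(e_i)=\sum_{k=1}^n r_{ik}e_k$. It is known that $r_{ii}\in\{0,-\lambda\}$, that $r_{ik}\in\{0,\lambda\}$ for all $k\neq i$ if $r_{ii}=0$, and $r_{ik}\in\{0,-\lambda\}$ for all $k\ne i$ if $r_{ii}=-\lambda$. Let $G=G(R)$ be the digraph on $V=\{1,\ldots,n\}$ with edge set $E=\{(i,k)\mid i\neq k,\ r_{ik}\neq0\}$; it is known to be acyclic, transitive, and to contain no induced subgraph on three distinct vertices $i,k,l$ with edge set exactly $\{(i,l),(k,l)\}$. For $i\in V$ let $f(i)$ be the length (number of edges) of the longest directed path in $G$ ending at $i$ (so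 $f(i)=0$ iff $i$ is a source). Then $T(R)$ is the rooted tree with vertex set $\{0,1,\ldots,n\}$, root $0$, and edges $(0,i)$ for all $i$ with $f(i)=0$ together with $(i,j)$ for all $(i,j)\in E$ with $f(i)=f(j)-1$. A non-root vertex $i$ is colored white if $r_{ii}=0$ and black if $r_{ii}=-\lambda$; the root is given a third color (grey). $T(R)$ is properly colored if adjacent vertices always have different colors, i.e. any two adjacent non-root vertices have different colors. *)

(* Defs.v *)
From HB Require Import structures.
From mathcomp Require Export all_boot all_order all_algebra.

Set Implicit Arguments.
Unset Strict Implicit.
Unset Printing Implicit Defensive.

Import GRing.Theory.
Local Open Scope ring_scope.

(* F^n with componentwise product (the library's pointwise ring structure on
   finite functions). The codomain is F^o, i.e. F seen as a module over itself,
   so that the type is also a vectType over F. Indices run over 0, ..., n-1. *)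
Notation powalg F n := {ffun 'I_n -> F^o}.

Section Defs.
Variables (F : fieldType) (n : nat).
Local Notation A := (powalg F n).
Implicit Types (lambda : F) (R : {linear A -> A}).

Definition idem (i : 'I_n) : A := [ffun j => (i == j)%:R].

Definition rota_baxter lambda R : Prop :=
  forall x y : A, R x * R y = R (R x * y + x * R y + lambda *: (x * y)).

(* The unit of A need not belong to U. *)
Definition subalgebra (U : {vspace A}) : Prop :=
  forall x y, x \in U -> y \in U -> x * y \in U.

Definition splitting lambda R : Prop :=
  exists A1 A2 : {vspace A},
    [/\ subalgebra A1, subalgebra A2,
        (A1 + A2)%VS = fullv, directv (A1 + A2) &
        forall a1 a2, a1 \in A1 -> a2 \in A2 ->
          R (a1 + a2) = (- lambda) *: a2].

Definition rbcoef R (i k : 'I_n) : F := R (idem i) k.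

Definition rbedge R : rel 'I_n := fun i k => (i != k) && (rbcoef R i k != 0).

(* Length of the longest directed path ending at i; a path of length k is given
   by its first vertex s and the sequence p of its k further vertices. The graph
   of a Rota-Baxter operator of nonzero weight is acyclic, so its paths do not
   repeat vertices and have length < n: the bound on k excludes no path. *)
Definition rbheight R (i : 'I_n) : nat :=
  (\max_(k < n | [exists s : 'I_n, [exists p : k.-tuple 'I_n,
                    path (rbedge R) s p && (last s p == i)]]) k)%N.

Inductive color := White | Black | Grey.

Record colored_rooted_digraph (V : Type) := ColoredRootedDigraph {
  root_vertex : V;
  arc_rel : rel V;
  vertex_color : V -> color }.

Definition adjacent V (T : colored_rooted_digraph V) : rel V :=
  fun u v => arc_rel T u v || arc_rel T v u.

Definition properly_colored V (T : colored_rooted_digraph V) : Prop :=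
  forall u v, adjacent T u v -> vertex_color T u <> vertex_color T v.

(* T(R): None is the root and Some i the vertex i; arcs point away from the
   root. For a Rota-Baxter operator of weight lambda != 0 the result is a tree,
   and the diagonal coefficients lie in {0, - lambda}, so that the last case of
   the coloring is the one of the coefficient - lambda. *)
Definition rbtree_arc R : rel (option 'I_n) := fun u v =>
  match u, v with
  | None, Some i => rbheight R i == 0%N
  | Some i, Some j => rbedge R i j && ((rbheight R i).+1 == rbheight R j)
  | _, None => false
  end.

Definition rbtree_color R (u : option 'I_n) : color :=
  match u with
  | None => Grey
  | Some i => if rbcoef R i i == 0 then White else Black
  end.

Definition rbtree R : colored_rooted_digraph (option 'I_n) :=
  ColoredRootedDigraph None (rbtree_arc R) (rbtree_color R).

End Defs.

(* Main.v *)
(* On the basis, the Rota-Baxter identity reads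
     r_ik r_jk = r_ij r_jk + r_ji r_ik + lambda [i = j] r_ik,
   and R is splitting iff R (R x) = - lambda R x, the two subalgebras being then
   ker R and im R.  If i is the parent of k in T(R), the ancestors of k are i and
   the ancestors of i, so that the k-th column of (r_ij) is the i-th one up to
   corrections in the rows i and k:
     r_jk = r_ji + [j = i] (r_ii + lambda) + [j = k] r_kk.
   Given R (R x) = - lambda R x, this forces r_ii + r_kk = - lambda, that is, i
   and k have different colors.  Conversely, if r_ii + r_kk = - lambda for all
   such pairs, it propagates the quadratic identity from the column of a parent
   to the columns of its children. *)
Require Import Defs.
From mathcomp Require Import all_boot all_order all_algebra.
From mathcomp Require Import ring.
Import GRing.Theory.
Local Open Scope ring_scope.

Section RotaBaxter.
Set Implicit Arguments.
Unset Strict Implicit.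
Variables (F : fieldType) (n : nat) (lambda : F).
Variable R : {linear powalg F n -> powalg F n}.
Hypotheses (lambda_neq0 : lambda != 0) (RB : rota_baxter lambda R).
Local Notation A := (powalg F n).
Local Notation r := (rbcoef R).
Local Notation e := (rbedge R).
Local Notation h := (rbheight R).

Lemma rb_apply (x : A) k : R x k = \sum_j x j * r j k.
Proof.
have {1}-> : x = \sum_j x j *: idem F j.
  apply/ffunP => l; rewrite sum_ffunE (bigD1 l) //= big1 => [|j jl].
    by rewrite !ffunE eqxx addr0 [_ *: _]mulr1.
  by rewrite !ffunE (negbTE jl) [_ *: _]mulr0.
by rewrite linear_sum sum_ffunE; apply: eq_bigr => j _; rewrite linearZ ffunE.
Qed.

Lemma splitting_iff_quadratic :
  splitting lambda R <-> forall x, R (R x) = - lambda *: R x.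
Proof.
split=> [[A1 [A2 [_ _ sumA _ RE]]] x|RR].
  have : x \in (A1 + A2)%VS by rewrite sumA memvf.
  case/memv_addP=> a1 a1A [a2 a2A ->].
  have la2A : - lambda *: a2 \in A2 by rewrite memvZ.
  by rewrite RE // -[in LHS](add0r (- lambda *: a2)) RE ?mem0v.
have kerE x : (x \in lker (linfun R)) = (R x == 0) by rewrite memv_ker lfunE.
have imgP x : reflect (exists y, x = R y) (x \in limg (linfun R)).
  apply: (iffP memv_imgP) => [[y _ ->]|[y ->]]; first by exists y; rewrite lfunE.
  by exists y; rewrite ?memvf ?lfunE.
exists (lker (linfun R)), (limg (linfun R)); split.
(* For x and y in the kernel the Rota-Baxter identity reduces to 0 = lambda R (x y). *)
- move=> x y; rewrite !kerE => /eqP Rx /eqP Ry.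
  have := RB x y; rewrite Rx Ry !(mul0r, mulr0, add0r) linearZ => /esym/eqP.
  by rewrite scaler_eq0 (negbTE lambda_neq0).
- move=> _ _ /imgP[x ->] /imgP[y ->]; apply/imgP.
  by eexists; apply: RB.
- apply/vspaceP=> x; rewrite memvf; apply/memv_addP.
  (* R should be - lambda times the projection onto its image, so the image component of x has to be
     - lambda^-1 R x. *)
  exists (x + lambda^-1 *: R x).
    by rewrite kerE linearD linearZ /= RR scalerA mulrN mulVf // scaleN1r subrr.
  exists (- (lambda^-1 *: R x)); last by rewrite addrK.
  by rewrite memvN memvZ //; apply/imgP; exists x.
- apply/directv_addP/eqP; rewrite -subv0; apply/subvP=> x.
  rewrite memv_cap kerE => /andP[/eqP Rx0 /imgP[y xE]].
  move: Rx0; rewrite xE RR => /eqP; rewrite scaler_eq0 oppr_eq0.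
  by rewrite (negbTE lambda_neq0) memv0.
- move=> a1 _ + /imgP[y ->]; rewrite kerE => /eqP Ra1.
  by rewrite linearD /= Ra1 add0r RR.
Qed.

Lemma quadratic_iff_coef :
  (forall x, R (R x) = - lambda *: R x) <->
  forall i k, \sum_j r i j * r j k = - lambda * r i k.
Proof.
split=> [RR i k|rr x]; first by rewrite -rb_apply RR ffunE.
apply/ffunP=> k; rewrite ffunE rb_apply.
under eq_bigr do rewrite rb_apply mulr_suml.
rewrite exchange_big rb_apply [RHS]mulr_sumr; apply: eq_bigr => i _.
under eq_bigr do rewrite -mulrA.
by rewrite -mulr_sumr rr mulrCA.
Qed.

Lemma rbcoef_mul i j k :
  r i k * r j k = r i j * r j k + r j i * r i k + (i == j)%:R * lambda * r i k.
Proof.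
have idemM (x : A) l : idem F l * x = x l *: idem F l.
  apply/ffunP=> m; rewrite !ffunE /=; case: eqVneq => [->|_].
    by rewrite mul1r [RHS]mulr1.
  by rewrite mul0r [RHS]mulr0.
have Midem (x : A) l : x * idem F l = x l *: idem F l.
  by rewrite -idemM; apply/ffunP=> m; rewrite !ffunE /= [LHS]mulrC.
have := RB (idem F i) (idem F j) => /(congr1 (fun x : A => x k)).
rewrite ffunE Midem !idemM 2!linearD 3!linearZ !ffunE /=.
rewrite /rbcoef => ->; rewrite eq_sym linearZ ffunE.
by rewrite [_ * lambda]mulrC -mulrA.
Qed.

Lemma rbcoef_diag i : r i i = 0 \/ r i i = - lambda.
Proof.
have /eqP := rbcoef_mul i i i; rewrite eqxx -subr_eq0.
have -> : r i i * r i i - (r i i * r i i + r i i * r i i + 1 * lambda * r i i)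
  = - (r i i * (r i i + lambda)) by ring.
rewrite oppr_eq0 mulf_eq0 addr_eq0.
by case/orP=> /eqP; [left | right].
Qed.

(** Cancelling r_ik in the case i = j of [rbcoef_mul] covers both colors at once: the value is
    lambda if r_ii = 0 and - lambda if r_ii = - lambda. *)
Lemma rbedge_coef i k : e i k -> r i k = r i i *+ 2 + lambda.
Proof.
case/andP=> _ rik0; have := rbcoef_mul i i k.
by rewrite eqxx mul1r => E; apply: (mulIf rik0); rewrite E; ring.
Qed.

(** For j = k the products r_ik r_kk cancel, leaving r_ki r_ik = 0. *)
Lemma rbedge_coef_rev i k : e i k -> r k i = 0.
Proof.
case/andP=> ik rik0; have := rbcoef_mul i k k.
rewrite (negbTE ik) !mul0r addr0 => /eqP.
rewrite -[eqbLHS]addr0 (inj_eq (addrI _)) eq_sym mulf_eq0 (negbTE rik0) orbF.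
by move/eqP.
Qed.

Lemma rbedge_irr : irreflexive e.
Proof. by move=> i; rewrite /rbedge eqxx. Qed.

Lemma rbedge_trans : transitive e.
Proof.
move=> j i k eij ejk; have [ij rij0] := andP eij; have [_ rjk0] := andP ejk.
have rji := rbedge_coef_rev eij; apply/andP; split.
  by apply: contra_neq rjk0 => <-.
have := rbcoef_mul i j k; rewrite rji (negbTE ij) !mul0r !addr0.
by move=> /(mulIf rjk0) ->.
Qed.

(** If r_ij = r_ji = 0 with i != j, the identity leaves r_ik r_jk = 0. So the ancestors of a vertex
    form a chain. *)
Lemma rbedge_common_target i j k : e i k -> e j k -> [|| i == j, e i j | e j i].
Proof.
move=> /andP[_ rik0] /andP[_ rjk0]; rewrite /rbedge [j == i]eq_sym.
case: (eqVneq i j) => //= ij.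
have := rbcoef_mul i j k; rewrite (negbTE ij) !mul0r addr0.
case: (eqVneq (r i j) 0) => //= ->; case: (eqVneq (r j i) 0) => //= ->.
by rewrite !mul0r addr0 => /eqP; rewrite mulf_eq0 (negbTE rik0) (negbTE rjk0).
Qed.

(** The edge relation is a strict order, so a path has distinct vertices and passes the bound in
    [rbheight]. *)
Lemma path_rbheight s p : path e s p -> (size p <= h (last s p))%N.
Proof.
move=> ep.
have : uniq (s :: p) by apply: (sorted_uniq rbedge_trans rbedge_irr).
move/card_uniqP => /= sz.
have ltn_p : (size p < n)%N by rewrite -sz -[n in leqRHS]card_ord max_card.
apply: (leq_bigmax_cond (Ordinal ltn_p)).
apply/existsP; exists s; apply/existsP; exists (in_tuple p).
by rewrite ep eqxx.
Qed.

Lemma rbheight_path i : exists s p, [/\ path e s p, last s p = i & size p = h i].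
Proof.
pose P (k : 'I_n) := [exists s, [exists p : k.-tuple 'I_n,
  path e s p && (last s p == i)]].
have n_gt0 : (0 < n)%N by apply: leq_ltn_trans (ltn_ord i).
(* The empty path at i makes the maximum range over a nonempty set, hence be attained. *)
have P0 : P (Ordinal n_gt0).
  by apply/existsP; exists i; apply/existsP; exists [tuple]; rewrite /= eqxx.
have [|k Pk hk] := @eq_bigmax_cond _ [pred k | P k] (@nat_of_ord n).
  by apply/card_gt0P; exists (Ordinal n_gt0).
have /existsP[s /existsP[p /andP[ep /eqP lp]]] := Pk.
by exists s, p; rewrite /rbheight hk size_tuple.
Qed.

Lemma rbedge_height i j : e i j -> (h i < h j)%N.
Proof.
move=> eij; have [s [p [ep lp <-]]] := rbheight_path i.
have := @path_rbheight s (rcons p j).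
by rewrite rcons_path size_rcons last_rcons lp ep eij; apply.
Qed.

(** The parent is the last vertex before k on a longest path ending at k. *)
Lemma rbheight_parent k : h k != 0%N -> exists2 i, e i k & (h i).+1 = h k.
Proof.
have [s [p [+ + hk]]] := rbheight_path k; rewrite -hk.
case/lastP: p hk => [//|p l]; rewrite rcons_path last_rcons size_rcons.
move=> hk /andP[ep +] lk _; rewrite {}lk => elk.
exists (last s p) => //; apply/eqP; rewrite eqSS eqn_leq path_rbheight // andbT.
by rewrite -ltnS hk rbedge_height.
Qed.

Lemma rbcoef_parent i k j : e i k -> (h i).+1 = h k ->
  r j k = r j i + (j == i)%:R * (r i i + lambda) + (j == k)%:R * r k k.
Proof.
move=> eik hik; have [ik rik0] := andP eik.
case: (eqVneq j i) => [->|ji].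
  by rewrite (negbTE ik) mul1r mul0r (rbedge_coef eik); ring.
case: (eqVneq j k) => [->|jk].
  by rewrite (rbedge_coef_rev eik) mul0r mul1r !add0r.
rewrite !mul0r !addr0; case: (boolP (e j i)) => [eji|Neji].
  by rewrite (rbedge_coef eji) (rbedge_coef (rbedge_trans eji eik)).
(* An ancestor j of k that is neither i nor above i would lie strictly between i and k, but their
   heights differ by 1. *)
case: (boolP (e j k)) => [ejk|Nejk].
  have := rbedge_common_target ejk eik; rewrite (negbTE ji) (negbTE Neji) /=.
  move/rbedge_height; rewrite -ltnS hik => hkj.
  by have := leq_trans hkj (rbedge_height ejk); rewrite ltnn.
by move: Neji Nejk; rewrite /rbedge ji jk /= !negbK => /eqP -> /eqP ->.
Qed.

Lemma sum_rbcoef_parent i k l : e l k -> (h l).+1 = h k ->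
  \sum_j r i j * r j k =
    \sum_j r i j * r j l + r i l * (r l l + lambda) + r i k * r k k.
Proof.
move=> elk hlk.
have sum_delta m (f : 'I_n -> F) : \sum_j (j == m)%:R * f j = f m.
  rewrite (bigD1 m) //= eqxx mul1r big1 ?addr0 // => j /negbTE ->.
  by rewrite mul0r.
rewrite -(sum_delta l (fun j => r i j * (r l l + lambda))).
rewrite -(sum_delta k (fun j => r i j * r k k)) -!big_split /=.
by apply: eq_bigr => j _; rewrite (rbcoef_parent j elk hlk); ring.
Qed.

(** Compare row i of the quadratic identity in the columns i and k, then cancel r_ik. *)
Lemma quadratic_parent :
  (forall i k, \sum_j r i j * r j k = - lambda * r i k) ->
  forall i k, e i k -> (h i).+1 = h k -> r i i + r k k = - lambda.
Proof.
move=> rr i k eik hik; have [ik rik0] := andP eik.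
apply: (mulIf rik0); rewrite -rr (sum_rbcoef_parent i eik hik) rr (rbedge_coef eik).
have [->|->] := rbcoef_diag i; ring.
Qed.

Lemma parent_quadratic :
  (forall i k, e i k -> (h i).+1 = h k -> r i i + r k k = - lambda) ->
  forall i k, \sum_j r i j * r j k = - lambda * r i k.
Proof.
move=> par i k; move: {-1}(h k) (erefl (h k)) => m.
elim: m k => [|m IHm] k hk.
  (* The column of a source is zero off the diagonal, which leaves r_kk^2 = - lambda r_kk. *)
  have rk0 j : j != k -> r j k = 0.
    move=> jk; apply: contraTeq (ltn0Sn (h j)) => rjk.
    by rewrite -leqNgt -{}hk rbedge_height // /rbedge jk.
  rewrite (bigD1 k) //= big1 => [|j /rk0 ->]; last by rewrite mulr0.
  rewrite addr0; case: (eqVneq i k) => [->|/rk0 ->]; last by rewrite mul0r mulr0.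
  by have [->|->] := rbcoef_diag k; ring.
have [l elk hlk] : exists2 l, e l k & (h l).+1 = h k.
  by apply: rbheight_parent; rewrite hk.
have hl : h l = m by move: hlk; rewrite hk => -[].
rewrite (sum_rbcoef_parent i elk hlk) IHm // (rbcoef_parent i elk hlk).
(* With r_kk eliminated, the two sides differ by a multiple of r_ll (r_ll + lambda) = 0. *)
have -> : r k k = - lambda - r l l by rewrite -(par _ _ elk hlk); ring.
by have [->|->] := rbcoef_diag l; ring.
Qed.

(** Diagonal entries are 0 or - lambda, and as lambda != 0 two of them sum to - lambda exactly when
    they differ, in any characteristic. *)
Lemma properly_colored_iff :
  properly_colored (rbtree R) <->
  forall i k, e i k -> (h i).+1 = h k -> r i i + r k k = - lambda.
Proof.
have Nlambda0 : (- lambda == 0) = false by rewrite oppr_eq0; apply: negbTE.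
split=> [col i k eik hik|par].
  have /= := col (Some i) (Some k); rewrite /adjacent /= eik hik eqxx.
  by case: (rbcoef_diag i) (rbcoef_diag k) => -> [] ->;
     rewrite ?eqxx ?Nlambda0 ?add0r ?addr0 // => /(_ isT).
have col i k : rbtree_arc R (Some i) (Some k) ->
    rbtree_color R (Some i) <> rbtree_color R (Some k).
  move=> /= /andP[eik /eqP hik]; have := par _ _ eik hik.
  have [->|->] := rbcoef_diag i; have [->|->] := rbcoef_diag k;
    rewrite ?eqxx ?Nlambda0 // => /eqP.
    by rewrite addr0 eq_sym Nlambda0.
  by rewrite -[eqbRHS]addr0 (inj_eq (addrI _)) Nlambda0.
(* Pairs involving the root are harmless: grey is the color of no other vertex. *)
move=> [i|] [k|]; rewrite /adjacent //=; try by case: ifP.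
by case/orP=> [/col//|/col ik /esym].
Qed.

End RotaBaxter.

Theorem theorem2 (F : fieldType) (n : nat) (lambda : F)
    (R : {linear powalg F n -> powalg F n})
    (n_ge1 : (1 <= n)%N) (lambda_neq0 : lambda != 0)
    (RB : rota_baxter lambda R) :
  splitting lambda R <-> properly_colored (rbtree R).
Proof.
apply: (iff_trans (splitting_iff_quadratic lambda_neq0 RB)).
apply: (iff_trans (quadratic_iff_coef lambda R)).
apply: (iff_trans _ (iff_sym (properly_colored_iff lambda_neq0 RB))).
by split; [apply: quadratic_parent | apply: parent_quadratic].
Qed.
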